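(* For every integer $k_0 \geq 4$ there is a $k \in \{k_0, k_0+1, \ldots, k_0+8\}$ such that for every integer $n \geq 4k$ there exists a graph $G$ on $n$ vertices with treewidth at most $k$ and maximum degree $\Delta = k + \lfloor \sqrt{k} \rfloor < k + \sqrt{k}$ such that $$2|E(G)| = \Delta n - (\Delta-k)(\Delta-k+1).$$ In particular, the graph $G$ is overfull whenever $n$ is odd.
   Context: All graphs are finite and simple. $\Delta(G)$ denotes the maximum degree of $G$. A graph $G$ is overfull if it has an odd number $n$ of vertices and strictly more than $\Delta(G)\tfrac{n-1}{2}$ edges. A tree-decomposition of $G$ consists of a tree $T$ and a collection of bags $B_t \subseteq V(G)$, $t\in V(T)$, such that (i) $V(G)=\bigcup_{t\in V(T)} B_t$; (ii) for each edge $vw\in E(G)$ there is $t\in V(T)$ with $v,w\in B_t$; (iii) if $v\in B_s\cap B_t$ then $v\in B_r$ for every vertex $r$ on the path connecting $s$ and $t$ in $T$. It has width $k$ if each bag has size at most $k+1$. The treewidth of $G$ is the smallest integer $k$ for which there is a width $k$ tree-decomposition of $G$. *)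

(* Defs.v *)
From mathcomp Require Import all_boot all_order all_algebra.
From mathcomp Require Import boolp reals.

Set Implicit Arguments.
Unset Strict Implicit.
Unset Printing Implicit Defensive.

Record sgraph := SGraph {
  vertex :> finType;
  adj : rel vertex;
  adj_sym : symmetric adj;
  adj_irr : irreflexive adj }.

Definition edges (G : sgraph) : {set {set G}} :=
  [set e | [exists x : G, exists y : G, adj x y && (e == [set x; y])]].

Definition degree (G : sgraph) (x : G) : nat := #|[set y | adj x y]|.

Definition max_degree (G : sgraph) : nat := \max_(x : G) degree x.

(* The halving is exact, as the order of [G] is odd. *)
Definition overfull (G : sgraph) : Prop :=
  odd #|G| /\ max_degree G * (#|G| - 1)./2 < #|edges G|.

(* An edge traversed back and forth is a [ucycle] of size 2; the cycles of a
   simple graph are those of size at least 3. *)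
Definition acyclic (T : sgraph) : Prop :=
  forall c : seq T, ucycle (@adj T) c -> size c < 3.

Definition is_tree (T : sgraph) : Prop :=
  [/\ 0 < #|T|, forall s t : T, connect (@adj T) s t & acyclic T].

Definition is_tree_decomposition (G T : sgraph) (B : T -> {set G}) : Prop :=
  [/\ is_tree T,
      forall v : G, exists t : T, v \in B t,
      forall v w : G, adj v w -> exists t : T, (v \in B t) && (w \in B t)
    & (* [s :: p] is the path from [s] to [last s p] *)
      forall (v : G) (s : T) (p : seq T),
        path (@adj T) s p -> uniq (s :: p) ->
        v \in B s -> v \in B (last s p) ->
        forall r : T, r \in s :: p -> v \in B r].

Definition has_tree_decomposition (G : sgraph) (k : nat) : Prop :=
  exists (T : sgraph) (B : T -> {set G}),
    is_tree_decomposition B /\ forall t : T, #|B t| <= k.+1.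

Fact unit_graph_sym : symmetric (fun _ _ : unit => false).
Proof. by []. Qed.

Fact unit_graph_irr : irreflexive (fun _ : unit => fun _ : unit => false).
Proof. by []. Qed.

Definition unit_graph : sgraph := SGraph unit_graph_sym unit_graph_irr.

Fact has_tree_decomposition_ex (G : sgraph) :
  exists k, `[< has_tree_decomposition G k >].
Proof.
exists #|G|; apply/asboolP; exists unit_graph, (fun=> [set: G]).
split; last by move=> t; rewrite cardsT leqnSn.
split=> [|v|v w _|v s p _ _ _ _ r _]; last by rewrite inE.
- split; [by rewrite card_unit | by move=> [] []; apply: connect0 |].
  by move=> [|x [|y c]] //= /andP[].
- by exists tt; rewrite inE.
- by exists tt; rewrite !inE.
Qed.

(* Widths are natural numbers, so the graph without vertices gets treewidth 0
   rather than -1. *)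
Definition treewidth (G : sgraph) : nat := ex_minn (has_tree_decomposition_ex G).

(* Main.v *)
(** Write d for the integer part of the square root of k.  In the k-th power of
    a path on n vertices, which has treewidth at most k, the vertex p (counted
    from 0) has degree p + k near the left end and 2k in the middle.  It thus
    suffices to delete a subgraph H so that every degree above k + d drops to
    k + d: the only vertices of smaller degree are then the d first ones and the
    d last ones, with total deficiency d (d + 1).

    The degrees required of H are 0 on the first d + 1 vertices, then 1, 2, ...,
    r := k - d, then constantly r, and symmetrically at the right end.  On the
    increasing part take the half graph p + q > k + d: its degrees are correct
    if loops are counted.  On the middle part take the r-regular graph formed by
    the powers up to r / 2 of a cycle that is folded onto the interval, so that
    edges still have length at most r.  Finally, the r / 2 loops are replaced by
    a matching into the r / 2 first vertices of the middle part, from which a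
    perfect matching is removed in exchange.  The latter exists if 4 divides r,
    which nine consecutive values of k allow together with d ^ 2 < k. *)
Require Import Defs.
From mathcomp Require Import all_boot all_order all_algebra.
From mathcomp Require Import boolp reals zify.

Set Implicit Arguments.
Unset Strict Implicit.
Unset Printing Implicit Defensive.

Import Order.TTheory GRing.Theory Num.Theory.

(** * The pieces of the deleted graph H *)

Definition ramp (d k p q : nat) : bool :=
  [&& d < p <= k, d < q <= k, p != q & k + d < p + q].

(** For [h = r / 2], the condition [k < p + h] selects the vertices with a loop in the half graph,
    as it amounts to [k + d < p + p]. *)
Definition stub (k h p q : nat) : bool :=
  [&& k < p + h, p <= k & q == p + h] || [&& k < q + h, q <= k & p == q + h].

(* The cycle passes through ..., b + 3, b + 1, b, b + 2, b + 4, ...; these are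
   the [r / 2] vertices next to [p] in the direction of [b].  Those in the other
   direction, towards the fold at the right end, are given by the mirror image. *)
Definition back (b r p q : nat) : bool :=
  [&& b <= p, b <= q &
      [&& q < p, odd p == odd q & p <= q + r] ||
      (odd p != odd q) && (p + q < r + b.*2)].

(* The matching {b, b + 1}, {b + 2, b + 3}, ... on [h] vertices. *)
Definition twin (b h p q : nat) : bool :=
  [&& b <= p < b + h, b <= q < b + h, p != q & (p - b)./2 == (q - b)./2].

Definition inner (n b p : nat) : bool := (b <= p) && (b <= n - p.+1).

Definition core (n k r h p q : nat) : bool :=
  [&& inner n k.+1 p, inner n k.+1 q,
      back k.+1 r p q || back k.+1 r (n - p.+1) (n - q.+1),
      ~~ twin k.+1 h p q & ~~ twin k.+1 h (n - p.+1) (n - q.+1)].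

(* The mirror image of the vertex [p] is [n - p.+1]. *)
Definition removed (n d g p q : nat) : bool :=
  let k := d + 4 * g in
  [|| ramp d k p q, ramp d k (n - p.+1) (n - q.+1),
      stub k (2 * g) p q, stub k (2 * g) (n - p.+1) (n - q.+1)
    | core n k (4 * g) (2 * g) p q].

Definition band (k p q : nat) : bool := [&& p != q, p <= q + k & q <= p + k].

(** * Degrees in the separate pieces *)

Lemma sum_interval (n a c : nat) :
  \sum_(q < n) ((a <= q < c) : nat) = minn c n - a.
Proof.
elim: n => [|n IHn]; first by rewrite big_ord0; lia.
by rewrite big_ord_recr /= IHn; lia.
Qed.

Lemma sum_pred1 (n a : nat) : \sum_(q < n) ((q == a :> nat) : nat) = (a < n).
Proof.
elim: n => [|n IHn]; first by rewrite big_ord0.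
by rewrite big_ord_recr /= IHn; lia.
Qed.

Lemma sum_rev (n : nat) (P : nat -> nat) :
  \sum_(q < n) P (n - q.+1) = \sum_(q < n) P q.
Proof. by rewrite [RHS](reindex_inj rev_ord_inj). Qed.

Lemma sum_ramp (n d k p : nat) : k < n ->
  \sum_(q < n) (ramp d k p q : nat)
    = (d < p <= k) * (p - d - (k + d < p + p)).
Proof.
move=> kn; case: (boolP (d < p <= k)) => hp; last first.
  by rewrite big1 // => q _; rewrite /ramp (negbTE hp).
(* With the loop at [p] restored, the neighbourhood is an interval. *)
suff: \sum_(q < n) (ramp d k p q : nat)
      + \sum_(q < n) (k + d < p + p) * ((q == p :> nat) : nat) =
      \sum_(q < n) ((k + d - p < q < k.+1) : nat).
  rewrite -big_distrr sum_pred1 sum_interval /= mul1n.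
  by case: (k + d < p + p); lia.
rewrite -big_split; apply: eq_bigr => q _ /=; rewrite /ramp; lia.
Qed.

Lemma sum_stub (n k h p : nat) : h <= k -> k + h < n ->
  \sum_(q < n) (stub k h p q : nat) = (k - h < p <= k + h).
Proof.
move=> hk kn.
have ->: \sum_(q < n) (stub k h p q : nat) = \sum_(q < n)
   ((k < p + h) && (p <= k)) * ((q == p + h :> nat) : nat)
   + \sum_(q < n)
   ((k < p) && (p <= k + h)) * ((q == p - h :> nat) : nat).
  by rewrite -big_split; apply: eq_bigr => q _ /=; rewrite /stub; lia.
by rewrite -!big_distrr !sum_pred1 /=; lia.
Qed.

(** The new neighbour is the vertex [h.+1] steps from [p] along the folded cycle; the test decides
    whether the walk has already turned at [b]. *)
Lemma back_double (b h p q : nat) : b <= p ->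
  (back b h.+1.*2 p q : nat) = back b h.*2 p q
    + (q == if b + h.+1.*2 <= p then p - h.+1.*2 else h.+1.*2 + b.*2 - p.+1).
Proof.
move=> bp; rewrite /back bp !andTb.
case: (leqP b q) => bq /=; last by case: ifP; lia.
case: (boolP (odd p == odd q)) => hpq /=.
  by rewrite !orbF; case: ifP => hp; lia.
by rewrite !andbF; case: ifP => hp; lia.
Qed.
Lemma sum_back (n b h p : nat) : b <= p < n -> b + h.*2 <= n ->
  \sum_(q < n) (back b h.*2 p q : nat) = h.
Proof.
move=> /andP[bp pn]; elim: h => [|h IHh] hn.
  by rewrite big1 // => q _; rewrite /back; lia.
under eq_bigr => q _ do rewrite (back_double _ _ bp).
rewrite big_split /= IHh ?sum_pred1; last lia.
by case: ifP; lia.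
Qed.

(** The matching is perfect because the number of vertices is even; with [r / 2] vertices this is
    where 4 has to divide r. *)
Lemma sum_twin (n b g p : nat) : b + g.*2 <= n ->
  \sum_(q < n) (twin b g.*2 p q : nat) = (b <= p < b + g.*2).
Proof.
move=> hn.
pose q0 := if odd (p - b) then p.-1 else p.+1.
have ->: \sum_(q < n) (twin b g.*2 p q : nat) =
         \sum_(q < n) (b <= p < b + g.*2) * ((q == q0 :> nat) : nat).
  apply: eq_bigr => q _; rewrite /twin /q0; case: ifP; lia.
by rewrite -big_distrr sum_pred1 /= /q0; case: ifP; lia.
Qed.

Lemma twin_back (b h p q : nat) : twin b h p q -> back b h.*2 p q.
Proof. rewrite /twin /back; lia. Qed.

Lemma twin_inner (n b h p q : nat) : h + b.*2 <= n -> twin b h p q ->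
  inner n b p && inner n b q.
Proof. rewrite /twin /inner; lia. Qed.

Lemma back_inner (n b r p q : nat) : r + b.*2 <= n -> inner n b p ->
  back b r p q -> inner n b q.
Proof. rewrite /back /inner; lia. Qed.

Lemma inner_rev (n b p : nat) : p < n -> inner n b (n - p.+1) = inner n b p.
Proof. rewrite /inner; lia. Qed.

(** The cycle has more than r vertices, so [r / 2] steps one way and [r / 2] the other reach no
    common vertex. *)
Lemma back_rev (n b r p q : nat) : r + b.*2 < n -> p < n -> q < n ->
  back b r p q -> back b r (n - p.+1) (n - q.+1) = false.
Proof.
move=> hn pn qn; rewrite /back => /and3P[bp bq]; apply: contraTF => /and3P[_ _].
have ->: (odd (n - p.+1) == odd (n - q.+1)) = (odd p == odd q) by lia.
by case: (odd p == odd q); rewrite /= ?orbF ?andbF; lia.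
Qed.

(** Twins are edges of the cycle power by [twin_back], and by [back_rev] no pair is counted in both
    directions. *)
Lemma core_twin (n k g p q : nat) : 2 * k + 4 * g + 2 < n -> p < n -> q < n ->
  core n k (4 * g) (2 * g) p q + twin k.+1 (2 * g) p q
     + twin k.+1 (2 * g) (n - p.+1) (n - q.+1)
  = inner n k.+1 p * (back k.+1 (4 * g) p q
                     + back k.+1 (4 * g) (n - p.+1) (n - q.+1)).
Proof.
move=> hn pn qn; rewrite /core (_ : 4 * g = (2 * g).*2); last lia.
have h1 : 2 * g + k.+1.*2 <= n by lia.
have h2 : (2 * g).*2 + k.+1.*2 < n by lia.
have := twin_inner h1 (p := p) (q := q).
have := twin_inner h1 (p := n - p.+1) (q := n - q.+1).
have := back_inner (ltnW h2) (p := p) (q := q).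
have := back_inner (ltnW h2) (p := n - p.+1) (q := n - q.+1).
have := back_rev h2 pn qn.
have := @twin_back k.+1 (2 * g) p q.
have := @twin_back k.+1 (2 * g) (n - p.+1) (n - q.+1).
rewrite !inner_rev //.
move: (inner _ _ p) (inner _ _ q) (back _ _ p q) (back _ _ _ _).
move: (twin _ _ p q) (twin _ _ _ _).
by do 6!case; do ?[by []|move=> /(_ isT)]; rewrite //= => *; lia.
Qed.

Lemma sum_core (n k g p : nat) : 2 * k + 4 * g + 2 < n -> p < n ->
  \sum_(q < n) (core n k (4 * g) (2 * g) p q : nat) + (k < p <= k + 2 * g)
     + (k < n - p.+1 <= k + 2 * g)
   = inner n k.+1 p * (4 * g).
Proof.
move=> hn pn.
have E4 : 4 * g = (2 * g).*2 by lia.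
have E2 : 2 * g = g.*2 by lia.
have <-: \sum_(q < n) (twin k.+1 (2 * g) p q : nat) = (k < p <= k + 2 * g).
  by rewrite E2 sum_twin; lia.
have <-: \sum_(q < n) (twin k.+1 (2 * g) (n - p.+1) (n - q.+1) : nat)
       = (k < n - p.+1 <= k + 2 * g).
  by rewrite (sum_rev _ (twin k.+1 (2 * g) (n - p.+1))) E2 sum_twin; lia.
rewrite -!big_split /=.
under eq_bigr => q _ do rewrite core_twin //.
rewrite -big_distrr big_split /=; case: (boolP (inner n k.+1 p)) => // hp.
rewrite (sum_rev _ (back k.+1 (4 * g) (n - p.+1))) E4.
by case/andP: hp => *; rewrite !sum_back; lia.
Qed.

(** * Degrees of H *)

Lemma removed_split (n d g p q : nat) : 0 < g -> 4 * (d + 4 * g) <= n ->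
    p < n -> q < n ->
  (removed n d g p q : nat) =
    ramp d (d + 4 * g) p q + ramp d (d + 4 * g) (n - p.+1) (n - q.+1)
  + stub (d + 4 * g) (2 * g) p q
  + stub (d + 4 * g) (2 * g) (n - p.+1) (n - q.+1)
  + core n (d + 4 * g) (4 * g) (2 * g) p q.
Proof.
move=> g0 hn pn qn; rewrite /removed; set k := d + 4 * g.
(* The pieces are disjoint: counted from its own end, a ramp stays within [k], a stub crosses [k],
   and the core lies beyond [k] from both ends; [4 * k <= n] keeps the ends apart. *)
have rampP a b : ramp d k a b -> (a <= k) && (b <= k) by rewrite /ramp; lia.
have stubP a b : stub k (2 * g) a b ->
    (a <= k) && (k < b <= k + 2 * g) || (b <= k) && (k < a <= k + 2 * g).
  by rewrite /stub /k; lia.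
have coreP : core n k (4 * g) (2 * g) p q ->
    [&& k < p, k < n - p.+1, k < q & k < n - q.+1].
  by case/and3P=> /andP[-> ->] /andP[-> ->].
move: (rampP p q) (rampP (n - p.+1) (n - q.+1)) (stubP p q)
  (stubP (n - p.+1) (n - q.+1)) coreP.
move: (ramp _ _ _ _) (ramp _ _ p q) (stub _ _ _ _) (stub _ _ p q).
move: (core _ _ _ _ _ _).
have kE : k = d + 4 * g by [].
by do 5!case; rewrite //=; lia.
Qed.

(** The right side is the excess of the band degree over [k + d], truncated at 0. A stub edge makes
    up for the missing loop at one end and for the missing twin at the other. *)
Lemma sum_removed (n d g p : nat) : 0 < g -> 0 < d -> 4 * (d + 4 * g) <= n ->
    p < n ->
  \sum_(q < n) (removed n d g p q : nat) =
  minn p (d + 4 * g) + minn (n - p.+1) (d + 4 * g) - (d + 4 * g + d).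
Proof.
move=> g0 d0 hn pn; under eq_bigr => q _ do rewrite removed_split //.
have := @sum_core n (d + 4 * g) g p; set k := d + 4 * g.
have kE : k = d + 4 * g by [].
move=> /(_ ltac:(lia) pn).
rewrite !big_split /= (sum_rev _ (ramp d k (n - p.+1))).
rewrite (sum_rev _ (stub k (2 * g) (n - p.+1))).
rewrite !sum_ramp ?sum_stub; [|lia..].
move: (\sum_(q < n) _) => C; rewrite /inner.
have [pk|kp] := leqP p k.
  have -> : k < n - p.+1 <= k + 2 * g = false by lia.
  have -> : d < n - p.+1 <= k = false by lia.
  have -> : k - 2 * g < n - p.+1 <= k + 2 * g = false by lia.
  have -> : k < n - p.+1 by lia.
  by rewrite !andbT /=; case: (ltnP d p) => dp /=; rewrite ?mul1n; lia.
rewrite andbF mul0n add0n; have [pk'|kp'] := leqP (n - p.+1) k.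
  have -> : p <= k + 2 * g = false by lia.
  rewrite !andbF /=.
  by case: (ltnP d (n - p.+1)) => dp /=; rewrite ?mul1n; lia.
rewrite andbF mul0n add0n /=; lia.
Qed.

(** * H inside the power of the path *)

Lemma sum_band (n k p : nat) : p < n ->
  \sum_(q < n) (band k p q : nat) = minn p k + minn (n - p.+1) k.
Proof.
move=> pn; have: \sum_(q < n) (band k p q : nat)
      + \sum_(q < n) ((q == p :> nat) : nat) =
      \sum_(q < n) ((p - k <= q < (p + k).+1) : nat).
  by rewrite -big_split; apply: eq_bigr => q _ /=; rewrite /band; lia.
by rewrite sum_pred1 sum_interval; lia.
Qed.

Lemma removed_band (n d g p q : nat) : 4 * (d + 4 * g) <= n ->
  p < n -> q < n -> removed n d g p q -> band (d + 4 * g) p q.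
Proof.
move=> hn pn qn; case/or4P.
1,2: by rewrite /ramp /band; lia.
  by rewrite /stub /band; lia.
case/orP; first by rewrite /stub /band; lia.
case/and3P=> _ _ /andP[+ _].
have backP a b : back (d + 4 * g).+1 (4 * g) a b -> band (d + 4 * g) a b.
  by rewrite /back /band; lia.
by case/orP => /backP; rewrite /band; lia.
Qed.

Lemma band_sym (k : nat) : symmetric (band k).
Proof. move=> p q; rewrite /band; lia. Qed.

Lemma removed_sym (n d g p q : nat) : p < n -> q < n ->
  removed n d g p q = removed n d g q p.
Proof.
have rampC a b k : ramp d k a b = ramp d k b a by rewrite /ramp; lia.
have stubC a b k : stub k (2 * g) a b = stub k (2 * g) b a
  by rewrite /stub orbC.
have twinC a b k : twin k (2 * g) a b = twin k (2 * g) b a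
  by rewrite /twin; lia.
(* An edge within one parity class changes direction when read from its other end, while one that
   passes a fold keeps it; only the union of both directions is symmetric. *)
have backC a b k r : inner n k a -> inner n k b -> a < n -> b < n ->
    back k r a b || back k r (n - a.+1) (n - b.+1) ->
    back k r b a || back k r (n - b.+1) (n - a.+1).
  move=> /andP[ka ka'] /andP[kb kb'] an bn; rewrite /back ka ka' kb kb' !andTb.
  have ->: (odd (n - a.+1) == odd (n - b.+1)) = (odd a == odd b) by lia.
  have ->: (odd (n - b.+1) == odd (n - a.+1)) = (odd a == odd b) by lia.
  rewrite [odd b == odd a]eq_sym.
  by case: (odd a == odd b); rewrite /= ?orbF ?andbF /=; lia.
move=> pn qn; rewrite /removed !(rampC q) !(rampC (n - q.+1)).
rewrite !(stubC q) !(stubC (n - q.+1)) /core (twinC q) (twinC (n - q.+1)).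
do 4![congr (_ || _)]; case: (boolP (inner _ _ p)) => ip; rewrite ?andbF //=.
case: (boolP (inner _ _ q)) => iq; rewrite ?andbF //=; congr (_ && _).
by apply/idP/idP; apply: backC.
Qed.

(** * Double counting of incidences *)

Lemma handshake (G : sgraph) : \sum_(x : G) degree x = 2 * #|edges G|.
Proof.
have adj_neq (x y : G) : adj x y -> x != y.
  by apply: contraTneq => ->; rewrite adj_irr.
have -> : \sum_(x : G) degree x =
          \sum_(x : G) \sum_(e in edges G) (x \in e : nat).
  apply: eq_bigr => x _; rewrite -big_mkcondr sum1dep_card /degree.
  (* The neighbours of [x] correspond to the edges at [x]. *)
  rewrite -[LHS](card_in_imset (f := fun y => [set x; y])).
    apply: eq_card => e; apply/imsetP/idP.
      case=> y; rewrite inE => xy ->; rewrite !inE eqxx andbT.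
      by apply/existsP; exists x; apply/existsP; exists y; rewrite xy /=.
    rewrite !inE => /andP[/existsP[u /existsP[v /andP[uv /eqP->]]]].
    rewrite !inE => /orP[]/eqP->; first by exists v; rewrite ?inE.
    by exists u; rewrite ?inE 1?adj_sym // setUC.
  move=> y z; rewrite !inE => xy xz /setP/(_ y).
  by rewrite !inE eqxx orbT eq_sym (negbTE (adj_neq _ _ xy)) => /esym/eqP.
rewrite exchange_big /= mulnC -sum_nat_const; apply: eq_bigr => e.
rewrite inE => /existsP[u /existsP[v /andP[uv /eqP->]]].
by rewrite -big_mkcond sum1_card cards2 (adj_neq _ _ uv).
Qed.

(** * Tree-decompositions along a path *)

Fact line_adj_sym (m : nat) :
  symmetric (fun x y : 'I_m => (x.+1 == y :> nat) || (y.+1 == x :> nat)).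
Proof. by move=> x y; rewrite orbC. Qed.

Fact line_adj_irr (m : nat) :
  irreflexive (fun x y : 'I_m => (x.+1 == y :> nat) || (y.+1 == x :> nat)).
Proof. by move=> x; rewrite orbb; lia. Qed.

Definition line (m : nat) : sgraph :=
  SGraph (@line_adj_sym m) (@line_adj_irr m).

(** Turning back would revisit the vertex before, so the first step fixes the direction. *)
Lemma line_path_up (m : nat) (s t : line m) (p : seq (line m)) :
  path (@adj (line m)) s (t :: p) -> uniq (s :: t :: p) -> s.+1 = t :> nat ->
  last t p = s + (size p).+1 :> nat /\
  forall r, r \in s :: t :: p -> s <= r <= last t p.
Proof.
elim: p s t => [|u p IHp] s t.
  move=> _ _ /= st; split=> [|r]; first by lia.
  by rewrite !inE => /orP[]/eqP->; lia.
move=> /andP[_ tup] /andP[+ us] st; rewrite !inE !negb_or => /and3P[_ su _].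
have /andP[tu _] := tup.
have tu' : t.+1 = u :> nat.
  by case/orP: tu => /eqP // ut; case/eqP: su; apply: val_inj => /=; lia.
have [] := IHp t u tup us tu'.
move=> /= lastE btw; split; first by rewrite lastE -st; lia.
move=> r; rewrite inE => /orP[/eqP->|/btw]; last by lia.
by rewrite leqnn lastE -st; lia.
Qed.

Lemma line_path_down (m : nat) (s t : line m) (p : seq (line m)) :
  path (@adj (line m)) s (t :: p) -> uniq (s :: t :: p) -> t.+1 = s :> nat ->
  last t p + (size p).+1 = s :> nat /\
  forall r, r \in s :: t :: p -> last t p <= r <= s.
Proof.
elim: p s t => [|u p IHp] s t.
  move=> _ _ /= st; split=> [|r]; first by lia.
  by rewrite !inE => /orP[]/eqP->; lia.
move=> /andP[_ tup] /andP[+ us] st; rewrite !inE !negb_or => /and3P[_ su _].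
have /andP[tu _] := tup.
have tu' : u.+1 = t :> nat.
  by case/orP: tu => /eqP // ut; case/eqP: su; apply: val_inj => /=; lia.
have [] := IHp t u tup us tu'.
move=> /= lastE btw; split; first by rewrite -st -lastE; lia.
move=> r; rewrite inE => /orP[/eqP->|/btw]; last by lia.
by rewrite leqnn -st -lastE; lia.
Qed.

Lemma line_connect0 (m : nat) (s : line m.+1) :
  connect (@adj (line m.+1)) ord0 s.
Proof.
case: s; elim=> [|i IHi] lti; first by apply: eq_connect0; apply: val_inj.
apply: connect_trans (IHi (ltnW lti)) (connect1 _).
by rewrite /= eqxx.
Qed.

Lemma line_tree (m : nat) : is_tree (line m.+1).
Proof.
split; first by rewrite card_ord.
  move=> s t; apply: connect_trans (line_connect0 t).
  by rewrite (sym_connect_sym (@adj_sym (line m.+1))) line_connect0.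
case=> [|s [|t p]] // /andP[]; rewrite [cycle _ _]/= rcons_path /=.
move=> /andP[st /andP[tp lasts]] us.
have path_st : path (@adj (line m.+1)) s (t :: p) by rewrite /= st tp.
(* By monotonicity the ends are [(size p).+1] apart, yet the closing edge makes them adjacent. *)
suff p0 : size p = 0 by rewrite /= p0.
move: lasts; rewrite /=; case/orP: st => /eqP st.
  have [-> _] := line_path_up path_st us st.
  by move: (nat_of_ord s) (size p) => a l; lia.
have [<- _] := line_path_down path_st us st.
by move: (nat_of_ord (last t p)) (size p) => a l; lia.
Qed.

Lemma line_path_between (m : nat) (s r : line m) (p : seq (line m)) :
  path (@adj (line m)) s p -> uniq (s :: p) -> r \in s :: p ->
  minn s (last s p) <= r <= maxn s (last s p).
Proof.
case: p => [|t p]; first by rewrite inE => _ _ /eqP->; rewrite /=; lia.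
move=> stp us rs; have /= /andP[st _] := stp.
case/orP: st => /eqP st.
  by have [_ /(_ r rs)] := line_path_up stp us st; rewrite /=; lia.
by have [_ /(_ r rs)] := line_path_down stp us st; rewrite /=; lia.
Qed.

Lemma treewidth_le (G : sgraph) (k : nat) :
  has_tree_decomposition G k -> treewidth G <= k.
Proof.
by rewrite /treewidth; case: ex_minnP => m _ min_m hk; apply/min_m/asboolP.
Qed.

(** The bags are the [n - k] windows of [k.+1] consecutive positions. *)
Lemma treewidth_band (G : sgraph) (n k : nat) (f : G -> 'I_n) : k < n ->
    injective f ->
    (forall x y, adj x y -> (f x <= f y + k) && (f y <= f x + k)) ->
  treewidth G <= k.
Proof.
move=> kn inj_f bandG; apply: treewidth_le.
pose m := n - k.+1.
exists (line m.+1), (fun t : 'I_m.+1 => [set v | t <= f v <= t + k]).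
have fn v : f v < n := ltn_ord (f v).
split; last first.
  move=> t; rewrite -(card_imset _ inj_f).
  have /subset_leq_card/leq_trans : f @: [set v | t <= f v <= t + k]
      \subset [set q : 'I_n | t <= q < (t + k).+1].
    by apply/subsetP => _ /imsetP[v + ->]; rewrite !inE.
  apply; rewrite -sum1dep_card big_mkcond.
  by rewrite (eq_bigr (fun q : 'I_n => (t <= q < (t + k).+1) : nat)) //
    sum_interval; lia.
split=> [|v|v w /bandG vw|v s p stp us]; first exact: line_tree.
- exists (inord (minn (f v) m)); rewrite inE inordK; move: (fn v); lia.
- exists (inord (minn (minn (f v) (f w)) m)).
  by rewrite !inE inordK; move: (fn v) (fn w); lia.
- rewrite !inE => vs vlast r rs; rewrite inE.
  by have := line_path_between stp us rs; lia.
Qed.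

(** * The graph G: degrees, edges and treewidth *)

Definition near_band (n d g : nat) (p q : 'I_n) : bool :=
  band (d + 4 * g) p q && ~~ removed n d g p q.

Fact near_band_sym (n d g : nat) : symmetric (@near_band n d g).
Proof. by move=> p q; rewrite /near_band band_sym removed_sym. Qed.

Fact near_band_irr (n d g : nat) : irreflexive (@near_band n d g).
Proof. by move=> p; rewrite /near_band /band eqxx. Qed.

Definition near_band_graph (n d g : nat) : sgraph :=
  SGraph (@near_band_sym n d g) (@near_band_irr n d g).

(** Deletion brings larger degrees down to exactly [k + d]; a position [p < d] has only [p + k]
    neighbours in the band and lacks [d - p]. *)
Lemma degree_near_band (n d g : nat) (p : near_band_graph n d g) :
    0 < g -> 0 < d -> 4 * (d + 4 * g) <= n ->
  degree p + ((d - val p) + (d - (n - (val p).+1))) = d + 4 * g + d.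
Proof.
move=> g0 d0 hn; set i := val p; have pn : i < n := ltn_ord p.
have: degree p + \sum_(q < n) (removed n d g i q : nat) =
      \sum_(q < n) (band (d + 4 * g) i q : nat).
  rewrite /degree -sum1dep_card big_mkcond -big_split; apply: eq_bigr => q _ /=.
  have := @removed_band n d g i q hn pn (ltn_ord q).
  rewrite /near_band -/i.
  by case: removed => [/(_ isT) ->|_]; rewrite ?andbF ?andbT //; case: band.
by rewrite sum_removed // sum_band //; lia.
Qed.

Lemma sum_staircase (n d : nat) : d <= n ->
  2 * \sum_(p < n) (d - p) = d * d.+1.
Proof.
elim: n d => [|n IHn] [|d] // dn; first by rewrite big_ord0.
  by rewrite big1.
rewrite big_ord_recl /= subn0 mulnDr IHn //; lia.
Qed.

Lemma edges_near_band (n d g : nat) :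
    0 < g -> 0 < d -> 4 * (d + 4 * g) <= n ->
  2 * #|edges (near_band_graph n d g)| + d * d.+1 = (d + 4 * g + d) * n.
Proof.
move=> g0 d0 hn; rewrite -handshake -(@sum_staircase n d); last lia.
rewrite mul2n -addnn -{1}(sum_rev n (fun p => d - p)) -!big_split /=.
rewrite -[n in RHS]card_ord mulnC -sum_nat_const; apply: eq_bigr => p _.
by rewrite -(degree_near_band p g0 d0 hn) [X in _ + X]addnC.
Qed.

Lemma max_degree_near_band (n d g : nat) :
    0 < g -> 0 < d -> 4 * (d + 4 * g) <= n ->
  max_degree (near_band_graph n d g) = d + 4 * g + d.
Proof.
move=> g0 d0 hn; apply/eqP; rewrite eqn_leq; apply/andP; split.
  by apply/bigmax_leqP => p _; rewrite -(degree_near_band p g0 d0 hn) leq_addr.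
(* Position [d] is the first one without deficiency. *)
have dn : d < n by lia.
apply: leq_trans (leq_bigmax (Ordinal dn : near_band_graph n d g)).
by rewrite -(degree_near_band (Ordinal dn) g0 d0 hn) /=; lia.
Qed.

Lemma near_band_treewidth (n d g : nat) : d + 4 * g < n ->
  treewidth (near_band_graph n d g) <= d + 4 * g.
Proof.
move=> kn; apply: (@treewidth_band (near_band_graph n d g) n _ id) => //.
by move=> p q /andP[/and3P[_ -> ->]].
Qed.

(** * The choice of k *)

(* Here [d + 4 * g] is k; the larger of the two candidate values of [d] is used
   when the first suitable k lies beyond the next square. *)
Lemma exists_window (k0 : nat) : 4 <= k0 ->
  exists d g, [/\ 0 < d, k0 <= d + 4 * g <= k0 + 8, d ^ 2 < d + 4 * g
                & d + 4 * g < d.+1 ^ 2].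
Proof.
move=> hk0.
have [d [d1 d2]] : exists d, d * d <= k0 /\ k0 < d.+1 * d.+1.
  elim: k0 {hk0} => [|k [d [d1 d2]]]; first by exists 0.
  by case: (ltnP k.+1 (d.+1 * d.+1)) => h; [exists d | exists d.+1]; lia.
have d_ge2 : 1 < d by case: d d1 d2 => [|[]] //=; lia.
(* Both quotients round up: [d + 4 * g] is the first candidate from [k0] on, [d.+1 + 4 * g'] the
   first one past the next square. *)
pose g := (k0 + 3 - d) %/ 4; pose g' := (d.+1 * d.+1 + 4 - d.+1) %/ 4.
have dd : d <= d * d by rewrite leq_pmulr //; lia.
have g1 : k0 <= d + 4 * g <= k0 + 3 by rewrite /g; lia.
have dd1 : d.+1 * d.+1 = d * d + 2 * d + 1 by lia.
have dd2 : d.+2 * d.+2 = d * d + 4 * d + 4 by lia.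
have [hlt|hge] := ltnP (d + 4 * g) (d.+1 * d.+1).
  (* A square is excluded by [d ^ 2 < k]; the next candidate [d * d + 4] is below [d.+1 ^ 2] since
     [d >= 2]. *)
  have [E|ne] := eqVneq (d + 4 * g) (d * d).
    by exists d, g.+1; rewrite -!mulnn; split; lia.
  by exists d, g; rewrite -!mulnn; split; lia.
have g2 : d.+1 * d.+1 < d.+1 + 4 * g' <= d.+1 * d.+1 + 4 by rewrite /g'; lia.
by exists d.+1, g'; rewrite -!mulnn; split; lia.
Qed.

Lemma sqrt_natrX (R : rcfType) (m : nat) :
  Num.sqrt ((m ^ 2)%:R : R)%R = (m%:R)%R.
Proof. by rewrite natrX sqrtr_sqr ger0_norm ?ler0n. Qed.

Lemma floor_sqrt (R : realType) (k d : nat) : d ^ 2 <= k < d.+1 ^ 2 ->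
  Num.floor (Num.sqrt (k%:R : R))%R = Posz d.
Proof.
move=> /andP[dk kd]; apply: floor_def; rewrite -PoszD addn1 -!pmulrn.
rewrite -(sqrt_natrX R d) -(sqrt_natrX R d.+1) ler_sqrt ?ler0n //.
rewrite ltr_sqrt ?ltr0n; last lia.
by rewrite ler_nat ltr_nat dk.
Qed.

Theorem proposition12 (R : realType) (k0 : nat) (hk0 : (4 <= k0)%N) :
  exists k : nat,
    (k0 <= k <= k0 + 8)%N /\
    forall n : nat, (4 * k <= n)%N ->
    exists G : sgraph,
      #|G| = n /\
      (treewidth G <= k)%N /\
      (Posz (max_degree G) = Posz k + Num.floor (Num.sqrt (k%:R : R)))%R /\
      ((max_degree G)%:R < k%:R + Num.sqrt (k%:R : R) :> R)%R /\
      (let D := Posz (max_degree G) in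
       2%:R * Posz #|edges G| =
         D * Posz n - (D - Posz k) * (D - Posz k + 1))%R /\
      (odd n -> overfull G).
Proof.
have [d [g [d0 k0k dk kd]]] := exists_window hk0.
exists (d + 4 * g); split=> // n hn; exists (near_band_graph n d g).
have g0 : 0 < g by case: g dk {k0k kd hn} => //; rewrite -mulnn; nia.
rewrite max_degree_near_band //; have edgesE := edges_near_band g0 d0 hn.
split; first by rewrite card_ord.
split; first by apply: near_band_treewidth; lia.
split; first by rewrite (@floor_sqrt R _ d) ?(ltnW dk) // -PoszD.
split.
  by rewrite natrD ltrD2l -(sqrt_natrX R d) ltr_sqrt ?ltr_nat ?ltr0n //; lia.
split; first by lia.
move=> n_odd; split; first by rewrite card_ord.
(* By the edge count, overfull means [d * d.+1 < k + d], that is, [d ^ 2 < k]. *)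
by rewrite max_degree_near_band // card_ord; nia.
Qed.
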